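(* Let $\mu$ be a Borel probability measure on $\mathbb{R}$ whose support is compact and infinite. Then for any $l,m,n\in\mathbb{N}$ with $l>m>n>1$, $$d(Z_l(\mu),Z_m(\mu))=\inf_{\substack{1\leq i\leq l\\ 1\leq j\leq m}}|x_{i,l}(\mu)-x_{j,m}(\mu)|\leq M_n(\mu).$$
   Context: $\mathbb{N}=\{1,2,\dots\}$. For a Borel probability measure $\mu$ on $\mathbb{R}$ with infinite compact support, $P_n(\cdot;\mu)$ denotes the $n$-th monic orthogonal polynomial for $\mu$, i.e. the monic polynomial of degree $n$ minimizing $\int|Q(x)|^2\,d\mu(x)$ among all monic polynomials $Q$ of degree $n$ (equivalently, orthogonal in $L_2(\mu)$ to all polynomials of degree less than $n$). Its zeros are real and simple and are enumerated as $x_{1,n}(\mu)<x_{2,n}(\mu)<\dots<x_{n,n}(\mu)$. Put $Z_n(\mu):=\{x: P_n(x;\mu)=0\}$, and for $n>1$ $$M_n(\mu):=\inf_{\substack{x,x'\in Z_n(\mu)\\ x\neq x'}}|x-x'|.$$ For $A,B\subset\mathbb{C}$, $d(A,B)=\inf_{a\in A,\,b\in B}|a-b|$ is the Euclidean distance between the sets. *)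

(* Defs.v *)
From HB Require Import structures.
From mathcomp Require Import all_boot all_order all_algebra.
From mathcomp Require Import all_classical all_reals all_analysis.
From mathcomp Require Import complex polyrcf.

Set Implicit Arguments.
Unset Strict Implicit.
Unset Printing Implicit Defensive.

Import Order.TTheory GRing.Theory Num.Theory.
Import numFieldNormedType.Exports.

Local Open Scope classical_set_scope.
Local Open Scope ring_scope.

Definition msupport (R : realType) (mu : probability (measurableTypeR R) R) :
    set R :=
  [set x | forall U : set R, open U -> U x -> (0 < mu U)%E].

Definition monic_deg (R : realType) (n : nat) (Q : {poly R}) : Prop :=
  Q \is monic /\ size Q = n.+1.

Definition sqnorm2 (R : realType) (mu : probability (measurableTypeR R) R)
    (Q : {poly R}) : \bar R :=
  (\int[mu]_x ((`|Q.[x]| ^+ 2)%:E))%E.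

Definition is_monic_orthopoly (R : realType)
    (mu : probability (measurableTypeR R) R) (n : nat) (P : {poly R}) : Prop :=
  monic_deg n P /\
  forall Q : {poly R}, monic_deg n Q -> (sqnorm2 mu P <= sqnorm2 mu Q)%E.

(* When the support of [mu] is compact and infinite the minimizer exists and is
   unique; [0] is only the default value of the choice operator. *)
Definition monic_orthopoly (R : realType)
    (mu : probability (measurableTypeR R) R) (n : nat) : {poly R} :=
  xget 0 [set P | is_monic_orthopoly mu n P].

(* All complex zeros, so that their being real is not built in. *)
Definition zero_set (R : realType)
    (mu : probability (measurableTypeR R) R) (n : nat) : set R[i] :=
  [set z | root (map_poly (real_complex R) (monic_orthopoly mu n)) z].

(* [rootsR] lists the real roots without repetition in increasing order; the
   index [i] starts from 1. *)
Definition zero_at (R : realType)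
    (mu : probability (measurableTypeR R) R) (i n : nat) : R :=
  (rootsR (monic_orthopoly mu n))`_i.-1.

(* [normc] is the complex modulus as an element of [R], whereas the norm
   [`|z|] of [z : R[i]] is an element of [R[i]]. *)
Definition set_dist (R : realType) (A B : set R[i]) : R :=
  inf [set ComplexField.Normc.normc (a - b) | a in A & b in B].

Definition min_gap (R : realType)
    (mu : probability (measurableTypeR R) R) (n : nat) : R :=
  inf [set r | exists x x' : R[i],
    [/\ zero_set mu n x, zero_set mu n x', x != x' &
        r = ComplexField.Normc.normc (x - x')]].

(* Main.v *)
Require Import Defs.
From HB Require Import structures.
From mathcomp Require Import all_boot all_order all_algebra.
From mathcomp Require Import all_classical all_reals all_analysis.
From mathcomp Require Import measurable_realfun.
From mathcomp Require Import complex polyrcf.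
From mathcomp Require Import ring lra zify.

(** Between any two zeros x < x' of the orthogonal polynomial P_n, every later
    orthogonal polynomial P_N, N > n, has a zero.  Applied to N = l and N = m,
    this puts a zero of P_l and a zero of P_m inside every gap of P_n, so these
    two zeros are closer to each other than x and x'.

    All of the polynomial part is about a positive definite linear functional L
    on polynomials, here integration against the measure.  Three facts carry it.

    - The minimizer of L (Q * Q) among monic Q of degree n is the monic
      polynomial orthogonal to all lower degrees ([orthopoly_minimizer]), by
      orthogonal projection and the theorem of Pythagoras.

    - Its zeros are real and simple ([orthopoly_real_roots],
      [orthopoly_factor]).  A nonreal zero a + i b, or a double zero a (with
      b = 0), makes d = (X - a)^2 + b^2 divide P = r d, and then L (P * r) is
      L of a sum of two squares, hence positive, against orthogonality.

    - The zeros separate ([orthopoly_zero_between]).  The polynomial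
      q = P_n^2 / ((X - x) (X - x')) satisfies L q = 0, and it is negative only
      inside ]x, x'[.  If P_N had no zero there, some h of degree < N would have
      h^2 = q at the zeros of P_N.  Then P_N divides q - h^2 with a quotient of
      degree < N, so L (h^2) = L q = 0, whence h = 0 and P_n vanishes at the N
      zeros of P_N, which is too many.  This is Gauss quadrature in disguise:
      the two statements used of it, exactness and positivity of the weights,
      are obtained at once from the square h^2.

    For the measure, compactness of the support makes all polynomials
    integrable, because the complement of the support is negligible
    ([negligible_msupportC]); infiniteness of the support makes the functional
    positive definite ([moment_functional_positive]), because a polynomial of
    zero norm vanishes on the support. *)

Import Order.TTheory GRing.Theory Num.Theory.
Import numFieldNormedType.Exports.

Local Open Scope classical_set_scope.
Local Open Scope ring_scope.

Set Implicit Arguments.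
Unset Strict Implicit.

(** * Polynomials over a field *)

Lemma interpolation (F : fieldType) (f : F -> F) (s : seq F) :
  uniq s -> exists2 h : {poly F},
    (size h <= size s)%N & {in s, forall y, h.[y] = f y}.
Proof.
elim: s => [_|y s IHs /= /andP[ys /IHs[h hs hE]]].
  by exists 0; rewrite ?size_poly0.
pose w := \prod_(z <- s) ('X - z%:P).
have wy : w.[y] != 0 by rewrite -rootE root_prod_XsubC.
exists (h + ((f y - h.[y]) / w.[y]) *: w).
  rewrite (leq_trans (size_polyD _ _))// geq_max (leq_trans hs)//=.
  by rewrite (leq_trans (size_scale_leq _ _))// size_prod_XsubC.
move=> z; rewrite !inE hornerD hornerZ => /predU1P[->|zs].
  by rewrite divfK // addrC subrK.
have /rootP -> : root w z by rewrite root_prod_XsubC.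
by rewrite mulr0 addr0 hE.
Qed.

Lemma size_sub_monic (R : nzRingType) n (p q : {poly R}) :
  p \is monic -> q \is monic -> size p = n.+1 -> size q = n.+1 ->
  (size (p - q)%R <= n)%N.
Proof.
move=> /monicP pm /monicP qm sp sq; rewrite -ltnS.
have [->|pq0] := eqVneq (p - q) 0; first by rewrite size_poly0.
have le : (size (p - q)%R <= n.+1)%N.
  by rewrite (leq_trans (size_polyD _ _))// size_polyN geq_max sp sq leqnn.
rewrite ltn_neqAle le andbT; apply: contra_neqN pq0 => /eqP spq.
apply/eqP; rewrite -lead_coef_eq0 lead_coefE spq coefB.
by move: pm qm; rewrite !lead_coefE sp sq /= => -> ->; rewrite subrr.
Qed.

Lemma size_XsubC_sqrD (R : idomainType) (a c : R) :
  size (('X - a%:P) ^+ 2 + c%:P) = 3%N.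
Proof.
rewrite size_polyDl size_exp_XsubC//.
by rewrite (leq_ltn_trans (size_polyC_leq1 _)).
Qed.

Lemma square_free_uniq (F : fieldType) (s : seq F) :
  (forall x, ~~ (('X - x%:P) ^+ 2 %| \prod_(y <- s) ('X - y%:P))) -> uniq s.
Proof.
elim: s => //= y s IHs; rewrite big_cons => sqf; apply/andP; split.
  apply: contra (sqf y) => ys.
  by rewrite expr2 dvdp_mul// dvdp_XsubCl root_prod_XsubC.
by apply: IHs => x; apply: contra (sqf x) => /dvdp_mull ->.
Qed.

(** * Orthogonality for a positive definite functional *)

Definition positive_definite (R : numFieldType) (L : {scalar {poly R}}) :=
  forall p : {poly R}, p != 0 -> 0 < L (p * p).

Definition orthopoly (R : numFieldType) (L : {scalar {poly R}}) (n : nat)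
    (P : {poly R}) :=
  [/\ P \is monic, size P = n.+1 &
      forall q : {poly R}, (size q <= n)%N -> L (P * q) = 0].

Lemma positive_definite_ge0 (R : numFieldType) (L : {scalar {poly R}}) p :
  positive_definite L -> 0 <= L (p * p).
Proof.
by move=> Lpos; have [->|/Lpos/ltW//] := eqVneq p 0; rewrite mul0r raddf0.
Qed.

(** Orthogonal projection on the polynomials of size at most n; the step adds
    the component along e = X^n - (projection of X^n), which is the next
    Gram-Schmidt vector. *)
Lemma orthogonal_projection (R : numFieldType) (L : {scalar {poly R}})
    (n : nat) (f : {poly R}) : positive_definite L ->
  exists2 q : {poly R}, (size q <= n)%N &
    forall s : {poly R}, (size s <= n)%N -> L ((f - q) * s) = 0.
Proof.
move=> Lpos; elim: n f => [|n IHn] f.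
  exists 0; first by rewrite size_poly0.
  by move=> s; rewrite leqn0 size_poly_eq0 => /eqP->; rewrite mulr0 raddf0.
have [q sq qP] := IHn f; have [r sr rP] := IHn 'X^n.
pose e := 'X^n - r.
have se : size e = n.+1.
  by rewrite /e size_polyDl ?size_polyXn// size_polyN ltnS.
have em : e \is monic.
  apply/monicP; rewrite /e lead_coefDl ?lead_coefXn//.
  by rewrite size_polyN size_polyXn ltnS.
have e0 : e != 0 by rewrite -size_poly_eq0 se.
have Le : L (e * e) != 0 by rewrite gt_eqF// Lpos.
have cE : L ((f - q) * e) / L (e * e) * L (e * e) = L ((f - q) * e).
  by rewrite divfK.
set c := _ / _ in cE; exists (q + c *: e).
  rewrite (leq_trans (size_polyD _ _))// geq_max (leq_trans sq)//=.
  by rewrite (leq_trans (size_scale_leq _ _))// se.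
move=> s ss.
have ss' : (size (s - s`_n *: e)%R <= n)%N.
  apply/leq_sizeP => j; rewrite leq_eqVlt coefB coefZ => /predU1P[<-|nj].
    have := monicP em; rewrite lead_coefE se /= => ->.
    by rewrite mulr1 subrr.
  rewrite (nth_default _ (leq_trans ss nj)) [e`_j]nth_default ?se//.
  by rewrite mulr0 subr0.
have -> : (f - (q + c *: e)) * s =
    s`_n *: ((f - q) * e) - s`_n *: (c *: (e * e))
    + (f - q) * (s - s`_n *: e) - c *: (e * (s - s`_n *: e)).
  by rewrite -!mul_polyC; ring.
have LZ a p : L (a *: p) = a * L p by rewrite linearZ.
rewrite (raddfB L) (raddfD L) (raddfB L) /= !LZ (qP _ ss') (rP _ ss').
by rewrite cE mulr0 subrr addr0 subr0.
Qed.

Lemma orthopoly_exists (R : numFieldType) (L : {scalar {poly R}}) (n : nat) :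
  positive_definite L -> exists P, orthopoly L n P.
Proof.
move=> Lpos; have [q sq qP] := orthogonal_projection n 'X^n Lpos.
exists ('X^n - q); split=> //.
  by apply/monicP; rewrite lead_coefDl ?lead_coefXn// size_polyN size_polyXn.
by rewrite size_polyDl ?size_polyXn// size_polyN ltnS.
Qed.

(** Q - P has degree less than n, hence is orthogonal to P. *)
Lemma orthopoly_pythagoras (R : numFieldType) (L : {scalar {poly R}}) n P Q :
  orthopoly L n P -> Q \is monic -> size Q = n.+1 ->
  L (Q * Q) = L (P * P) + L ((Q - P) * (Q - P)).
Proof.
move=> [Pm Ps Po] Qm Qs.
have -> : Q * Q = P * P + (Q - P) * (Q - P) + (P * (Q - P) + P * (Q - P)).
  by ring.
by rewrite !(raddfD L) /= (Po (Q - P)) ?addr0 ?size_sub_monic.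
Qed.

(** Conversely to the easy direction, a minimizer P is compared with an
    orthogonal Q: by Pythagoras L ((P - Q) * (P - Q)) cannot be positive. *)
Lemma orthopoly_minimizer (R : numFieldType) (L : {scalar {poly R}}) n P :
  positive_definite L ->
  (orthopoly L n P <-> (P \is monic /\ size P = n.+1) /\
   forall Q, Q \is monic /\ size Q = n.+1 -> L (P * P) <= L (Q * Q)).
Proof.
move=> Lpos; split=> [PO|[[Pm Ps] Pmin]].
  have [Pm Ps _] := PO; split=> // Q [Qm Qs].
  by rewrite (orthopoly_pythagoras PO Qm Qs) lerDl positive_definite_ge0.
have [Q QO] := orthopoly_exists n Lpos; have [Qm Qs _] := QO.
have := Pmin _ (conj Qm Qs); rewrite (orthopoly_pythagoras QO Pm Ps) gerDl => le0.
by have [/subr0_eq-> //|/Lpos/lt_geF] := eqVneq (P - Q) 0; rewrite le0.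
Qed.

(** * Zeros of orthogonal polynomials *)

(** If P = r d with d = (X - a)^2 + b^2, then P r = ((X - a) r)^2 + (b r)^2,
    so L (P * r) > 0, whereas r has degree less than n.  Taking b = 0 excludes
    double zeros, and b <> 0 excludes the zeros a + i b and a - i b. *)
Lemma orthopoly_ndvdp (R : rcfType) (L : {scalar {poly R}}) n P (a b : R) :
  positive_definite L -> orthopoly L n P ->
  ~~ (('X - a%:P) ^+ 2 + (b ^+ 2)%:P %| P).
Proof.
move=> Lpos [Pm Ps Po]; apply/negP => /dvdpP[r Pr].
set d := _ + _ in Pr.
have sd : size d = 3%N := size_XsubC_sqrD a (b ^+ 2).
have d0 : d != 0 by rewrite -size_poly_eq0 sd.
have r0 : r != 0.
  by apply: contra_eq_neq Ps => r0; rewrite Pr r0 mul0r size_poly0.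
have sr : (size r <= n)%N.
  by move: Ps; rewrite Pr size_mul// sd addn3 => -[<-].
have := Po r sr.
have -> : P * r = (('X - a%:P) * r) * (('X - a%:P) * r)
    + (b%:P * r) * (b%:P * r).
  by rewrite Pr /d expr2 [b ^+ 2]expr2 polyCM; ring.
rewrite (raddfD L) /= => /eqP; rewrite gt_eqF// ltr_wpDr ?positive_definite_ge0//.
by rewrite Lpos// mulf_neq0// polyXsubC_eq0.
Qed.

Lemma orthopoly_real_roots (R : rcfType) (L : {scalar {poly R}}) n P z :
  positive_definite L -> orthopoly L n P ->
  root (map_poly (real_complex R) P) z -> complex.Im z = 0.
Proof.
move=> Lpos PO; case: z => a b /= Pz.
apply/eqP/negPn/negP => b0; have /negP := orthopoly_ndvdp a b Lpos PO.
set d := _ + _; apply.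
have sd : size d = 3%N := size_XsubC_sqrD a (b ^+ 2).
have dz : (map_poly (real_complex R) d).[(a +i* b)%C] = 0.
  rewrite /d rmorphD rmorphXn rmorphB /= map_polyX !map_polyC /= !hornerE.
  by apply/eqP; rewrite eq_complex /=; apply/andP; split; apply/eqP; ring.
(* The remainder of P by d is real, of degree at most 1, and vanishes at the
   nonreal point z: it is zero. *)
have : (size (P %% d)%R <= 2)%N.
  by rewrite -ltnS -sd ltn_modp -size_poly_eq0 sd.
move: Pz; rewrite {1}(divp_eq P d) rmorphD rmorphM rootE /= hornerD hornerM dz.
rewrite mulr0 add0r /dvdp; set r := P %% d => rz sr.
have rE : r = r`_1 *: 'X + (r`_0)%:P.
  apply/polyP => i; rewrite coefD coefZ coefX coefC.
  case: i => [|[|i]] /=; rewrite ?mulr0 ?mulr1 ?add0r ?addr0//.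
  by rewrite nth_default// (leq_trans sr).
move: rz; rewrite rE rmorphD /= map_polyZ map_polyX map_polyC /= !hornerE.
rewrite eq_complex /= => /andP[/eqP e1 /eqP e2].
have r1 : r`_1 = 0.
  by apply/eqP; rewrite -(mulIr_eq0 _ (mulIf b0)); apply/eqP; lra.
have r0 : r`_0 = 0 by move: e1; rewrite r1; lra.
by rewrite r1 r0 scale0r add0r.
Qed.

(** Over the complex numbers P splits, with real zeros only; the factorization
    thus descends to the reals, where it is square-free. *)
Lemma orthopoly_factor (R : rcfType) (L : {scalar {poly R}}) n P :
  positive_definite L -> orthopoly L n P ->
  P = \prod_(x <- rootsR P) ('X - x%:P) /\ size (rootsR P) = n.
Proof.
move=> Lpos PO; have [Pm Ps _] := PO; have P0 := monic_neq0 Pm.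
have [zs] := closed_field_poly_normal (map_poly (real_complex R) P).
rewrite lead_coef_map (monicP Pm) rmorph1 scale1r => Pzs.
have real_zs : {in zs, forall z, z = (complex.Re z)%:C%C}.
  move=> z zzs; have /(orthopoly_real_roots Lpos PO) :
      root (map_poly (real_complex R) P) z by rewrite Pzs root_prod_XsubC.
  by case: z {zzs} => a b /= ->.
pose s := [seq complex.Re z | z <- zs].
have Ps' : P = \prod_(x <- s) ('X - x%:P).
  apply: (map_poly_inj (real_complex R)); rewrite Pzs rmorph_prod big_map.
  apply: eq_big_seq => z /real_zs {1}->.
  by rewrite rmorphB /= map_polyX map_polyC.
have us : uniq s.
  apply: square_free_uniq => x; rewrite -Ps'.
  by have := orthopoly_ndvdp x 0 Lpos PO; rewrite expr0n addr0.
have sR : perm_eq s (rootsR P).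
  apply: uniq_perm => //.
    exact: (sorted_uniq lt_trans ltxx (sorted_roots _ _ _)).
  by move=> x; rewrite -roots_on_rootsR// Ps' root_prod_XsubC.
split; first by rewrite [LHS]Ps'; exact: perm_big.
by move: Ps; rewrite -(perm_size sR) {1}Ps' size_prod_XsubC => -[].
Qed.

(** Stieltjes separation.  If Q had no zero in ]x, x'[, then
    q = P^2 / ((X - x) (X - x')), for which L q = 0, would agree with a square
    h^2 at the zeros of Q; as Q divides q - h^2, L (h^2) would vanish as well. *)
Lemma orthopoly_zero_between (R : rcfType) (L : {scalar {poly R}}) n N P Q x x' :
  positive_definite L -> orthopoly L n P -> orthopoly L N Q -> (n < N)%N ->
  root P x -> root P x' -> x < x' ->
  exists2 y, y \in rootsR Q & x < y < x'.
Proof.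
move=> Lpos PO QO nN Px Px' xx'; have [Pm Ps Po] := PO; have [Qm Qs Qo] := QO.
have P0 := monic_neq0 Pm; have Q0 := monic_neq0 Qm.
have uQ : uniq (rootsR Q) := sorted_uniq lt_trans ltxx (sorted_roots _ _ _).
have [QE sQ] := orthopoly_factor Lpos QO.
apply/hasP/negPn/negP => /hasPn no_zero.
have /(uniq_roots_prod_XsubC (rs := [:: x; x']))[|r Pr] : all (root P) [:: x; x'].
  by rewrite /= Px Px'.
  by rewrite uniq_rootsE /= inE lt_eqF.
rewrite big_cons big_seq1 in Pr.
have sr : (size r <= n)%N.
  have r0 : r != 0 by apply: contraNneq P0 => r0; rewrite Pr r0 mul0r.
  have w0 : ('X - x%:P) * ('X - x'%:P) != 0.
    by rewrite mulf_neq0 ?polyXsubC_eq0.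
  have sw : size (('X - x%:P) * ('X - x'%:P)) = 3%N.
    by rewrite size_mul ?polyXsubC_eq0// !size_XsubC.
  by move: Ps; rewrite Pr size_mul// sw addn3 => -[<-].
(* q is P^2 / ((X - x) (X - x')), and L q = 0 as r has degree less than n. *)
pose q := P * r.
have q_ge0 y : y \in rootsR Q -> 0 <= q.[y].
  move=> /no_zero; rewrite negb_and -!leNgt => nb.
  have -> : q.[y] = r.[y] ^+ 2 * ((y - x) * (y - x')).
    by rewrite /q Pr !hornerM !hornerXsubC; ring.
  rewrite mulr_ge0 ?sqr_ge0//.
  by case/orP: nb => nb; [rewrite mulr_le0|rewrite mulr_ge0] => //; lra.
have [h hs hE] := interpolation (fun y => Num.sqrt q.[y]) uQ.
have : Q %| q - h * h.
  rewrite QE uniq_roots_dvdp ?uniq_rootsE//; apply/allP => y yQ.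
  rewrite rootE hornerD hornerN [(h * h).[y]]hornerM hE// -expr2.
  by rewrite sqr_sqrtr ?subrr// q_ge0.
move=> /dvdpP[t tE].
(* Here n < N matters: q has degree 2n - 2 and h * h has degree at most 2N - 2,
   so that the quotient t by Q is of degree less than N and orthogonal to Q. *)
have st : (size t <= N)%N.
  have [->|t0] := eqVneq t 0; first by rewrite size_poly0.
  have sq : (size q <= n + n)%N.
    rewrite (leq_trans (size_polyMleq P r))// Ps addSn /=.
    by rewrite leq_add2l.
  have sh : (size (h * h)%R <= N + N)%N.
    rewrite sQ in hs; rewrite (leq_trans (size_polyMleq h h))//.
    by rewrite (leq_trans (leq_pred _))// leq_add.
  have : (size (q - h * h)%R = size t + N)%N.
    by rewrite tE size_mul// Qs addnS.
  move=> sE; rewrite -(leq_add2r N) -sE (leq_trans (size_polyD _ _))//.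
  rewrite size_polyN geq_max sh.
  by rewrite andbT (leq_trans sq)// leq_add// ltnW.
have Lh : L (h * h) = 0.
  have -> : h * h = q - Q * t by rewrite [Q * t]mulrC -tE; ring.
  by rewrite (raddfB L) /= Qo// Po// subrr.
have h0 : h = 0.
  by have [//|/Lpos] := eqVneq h 0; rewrite Lh ltxx.
have : (size (rootsR Q) < size P)%N.
  rewrite max_poly_roots//; apply/allP => y yQ.
  have /esym/eqP := hE y yQ; rewrite h0 horner0 sqrtr_eq0 => qy.
  have : q.[y] == 0 by rewrite eq_le qy q_ge0.
  rewrite /q hornerM mulf_eq0 => /orP[//|ry].
  by rewrite Pr rootM rootE ry.
by rewrite sQ Ps; lia.
Qed.

(** * Integration of polynomials *)

Lemma negligible_countable_bigcup d (T : measurableType d) (R : realType)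
    (mu : {measure set T -> \bar R}) (I : countType) (F : I -> set T) :
  (forall i, mu.-negligible (F i)) -> mu.-negligible (\bigcup_i F i).
Proof.
move=> F0; apply: (@negligibleS _ _ _ mu
    (\bigcup_k (if unpickle k is Some i then F i else set0))).
  by move=> x [i _ Fix]; exists (pickle i); rewrite ?pickleK.
apply: negligible_bigcup => k; case: unpickle => //; exact: negligible_set0.
Qed.

(** Every point off the support lies in a null open set, hence in a null open
    interval with rational endpoints, and these are countably many. *)
Lemma negligible_msupportC (R : realType)
    (mu : probability (measurableTypeR R) R) :
  mu.-negligible (~` msupport mu).
Proof.
pose F (q : rat * rat) : set R :=
  if mu `]ratr q.1, ratr q.2[%classic == 0%E then `]ratr q.1, ratr q.2[%classic
  else set0.
apply: (@negligibleS _ _ _ mu (\bigcup_q F q)); last first.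
  apply: negligible_countable_bigcup => q; rewrite /F.
  case: ifPn => [/eqP q0|_]; last exact: negligible_set0.
  exact/negligibleP.
move=> x /= /existsNP[U /not_implyP[oU /not_implyP[Ux /negP]]].
rewrite -leNgt measure_le0 => /eqP U0.
have : nbhs x U by exact: open_nbhs_nbhs.
rewrite -nbhs_ballE => -[e /= e0 xeU].
have [a] : exists q, ratr q \in `]x - e, x[ by apply: rat_in_itvoo; lra.
have [b] : exists q, ratr q \in `]x, x + e[ by apply: rat_in_itvoo; lra.
rewrite !in_itv /= => /andP[xb be] /andP[ea ax].
exists (a, b) => //; rewrite /F ifT /=; first by rewrite in_itv /= ax xb.
rewrite -measure_le0 -U0 le_measure ?inE//; first exact: open_measurable.
apply: subset_trans xeU => y /=; rewrite in_itv /= => /andP[ay yb].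
by rewrite /ball /= ltr_norml; lra.
Qed.

Lemma measurable_horner (R : realType) (p : {poly R}) :
  measurable_fun [set: measurableTypeR R] (fun x => p.[x]).
Proof. by apply: continuous_measurable_fun; exact: continuous_horner. Qed.

(** A polynomial is bounded on the compact support, which has full measure. *)
Lemma integrable_horner (R : realType)
    (mu : probability (measurableTypeR R) R) (p : {poly R}) :
  compact (msupport mu) -> mu.-integrable setT (EFin \o horner p).
Proof.
move=> cS; have [N [mN N0 SN]] := negligible_msupportC mu.
have mp := @measurable_horner R p.
apply/(negligible_integrable mN) => //; first exact/measurable_EFinP.
have mTN : measurable ([set: measurableTypeR R] `\` N) by exact: measurableD.
apply: measurable_bounded_integrable => //.
- by rewrite (le_lt_trans (probability_le1 _ _))// ltry.
- exact: measurable_funS mp.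
have /compact_bounded : compact (horner p @` msupport mu).
  by apply: continuous_compact => //; apply: continuous_subspaceT;
    exact: continuous_horner.
move=> [M [Mreal MP]]; exists M; split=> // k /MP{}MP x [_ Nx]; apply: MP.
exists x => //.
by apply: contrapT => Sx; apply/Nx/SN.
Qed.

Lemma moment_functional (R : realType)
    (mu : probability (measurableTypeR R) R) :
  compact (msupport mu) ->
  exists L : {scalar {poly R}}, forall p, (\int[mu]_x (p.[x])%:E = (L p)%:E)%E.
Proof.
move=> cS; pose l (p : {poly R}) : R^o := \int[mu]_x p.[x].
have lin : linear_for *%R l.
  move=> a p q; rewrite /l.
  have iap : mu.-integrable setT (EFin \o (fun x : measurableTypeR R => a * p.[x])).
    have := integrable_horner (a *: p) cS; congr integrable.
    by apply/funext => x /=; rewrite hornerZ.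
  have ip := integrable_horner p cS; have iq := integrable_horner q cS.
  rewrite -RintegralZl// -RintegralD//.
  by apply: eq_Rintegral => x _; rewrite hornerD hornerZ.
pose L : {scalar {poly R}} := HB.pack l (GRing.isLinear.Build _ _ _ _ l lin).
exists L => p; rewrite /= /l /Rintegral fineK//.
by apply: integrable_fin_num => //; exact: integrable_horner.
Qed.

(** If p^2 has zero integral, the open set where p does not vanish is null and
    so misses the support, which is then contained in the finite set of roots
    of p. *)
Lemma moment_functional_positive (R : realType)
    (mu : probability (measurableTypeR R) R) (L : {scalar {poly R}}) :
  infinite_set (msupport mu) ->
  (forall p, (\int[mu]_x (p.[x])%:E = (L p)%:E)%E) -> positive_definite L.
Proof.
move=> iS LE p p0; rewrite lt_neqAle -lee_fin -LE; apply/andP; split; last first.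
  by apply: integral_ge0 => x _; rewrite hornerM -expr2 lee_fin sqr_ge0.
apply/eqP => Lp0; apply: iS; apply: (@sub_finite_set _ _ [set` rootsR p]) => //.
move=> x Sx /=; rewrite -roots_on_rootsR//; apply/negPn/negP => px.
have mp : measurable_fun [set: measurableTypeR R] (fun x => ((p * p).[x])%:E).
  by apply/measurable_EFinP; exact: measurable_horner.
have oU : open [set y | p.[y] != 0].
  apply: (@open_comp _ _ (horner p) [set y : R | y != 0]); last exact: open_neq.
  by move=> y _; exact: continuous_horner.
have : (\int[mu]_x `| ((p * p).[x])%:E | = 0)%E.
  under eq_integral do
    rewrite gee0_abs ?hornerM ?lee_fin -?expr2 ?sqr_ge0// expr2 -hornerM.
  by rewrite LE -Lp0.
move=> /(ae_eq_integral_abs _ measurableT mp)[N [mN N0 UN]].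
have := Sx _ oU px; rewrite lt_neqAle => /andP[/eqP + _]; apply; apply/esym.
apply/eqP; rewrite -measure_le0 -N0 le_measure ?inE//; first exact: open_measurable.
move=> y /= py; apply: UN => /= /(_ I)/eqP; rewrite eqe hornerM mulf_eq0 orbb.
exact/negP.
Qed.

(** * The zeros attached to a measure *)

(** A minimizer exists, so the default value of the choice operator is not
    taken; every minimizer, hence the chosen one, is orthogonal. *)
Lemma monic_orthopolyP (R : realType)
    (mu : probability (measurableTypeR R) R) (L : {scalar {poly R}}) n :
  (forall p, (\int[mu]_x (p.[x])%:E = (L p)%:E)%E) -> positive_definite L ->
  orthopoly L n (monic_orthopoly mu n).
Proof.
move=> LE Lpos.
have sqE (Q : {poly R}) : sqnorm2 mu Q = (L (Q * Q))%:E.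
  rewrite -LE; apply: eq_integral => x _.
  by rewrite hornerM -expr2 real_normK// num_real.
have minE P : is_monic_orthopoly mu n P <-> orthopoly L n P.
  rewrite orthopoly_minimizer//; split=> -[Pm Pmin]; split=> // Q /Pmin;
    by rewrite !sqE lee_fin.
apply/minE; have [P /minE PO] := orthopoly_exists n Lpos.
exact: (xgetPex 0 (ex_intro _ P PO)).
Qed.

Lemma zero_setE (R : realType) (mu : probability (measurableTypeR R) R)
    (L : {scalar {poly R}}) n :
  (forall p, (\int[mu]_x (p.[x])%:E = (L p)%:E)%E) -> positive_definite L ->
  zero_set mu n =
    [set z | exists2 i, (1 <= i <= n)%N & z = (zero_at mu i n)%:C%C].
Proof.
move=> LE Lpos; have PO := monic_orthopolyP n LE Lpos.
have [PE sP] := orthopoly_factor Lpos PO.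
apply/seteqP; split=> [z Pz|_ [i /andP[i1 ile] ->]].
  have := orthopoly_real_roots Lpos PO Pz; case: z Pz => a b /= + b0.
  rewrite b0 /zero_set /= (fmorph_root (real_complex R)) PE root_prod_XsubC => aP.
  exists (index a (rootsR (monic_orthopoly mu n))).+1.
    by rewrite /= -[X in (_ <= X)%N]sP index_mem.
  by rewrite /zero_at /= nth_index.
rewrite /zero_set /= (fmorph_root (real_complex R)) PE root_prod_XsubC.
by rewrite mem_nth// sP prednK.
Qed.

Lemma normc_real_sub (R : rcfType) (a b : R) :
  ComplexField.Normc.normc (a%:C - b%:C)%C = `|a - b|.
Proof. by rewrite /= oppr0 addr0 expr0n addr0 sqrtr_sqr. Qed.

Unset Implicit Arguments.
Set Strict Implicit.

Theorem proposition3p1 (R : realType)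
    (mu : probability (measurableTypeR R) R)
    (mu_compact : compact (msupport mu))
    (mu_infinite : infinite_set (msupport mu))
    (l m n : nat) (hlm : (m < l)%N) (hmn : (n < m)%N) (hn : (1 < n)%N) :
  set_dist (zero_set mu l) (zero_set mu m) =
    inf [set r : R | exists i j : nat,
      [/\ (1 <= i <= l)%N, (1 <= j <= m)%N &
          r = `|zero_at mu i l - zero_at mu j m|]] /\
  inf [set r : R | exists i j : nat,
      [/\ (1 <= i <= l)%N, (1 <= j <= m)%N &
          r = `|zero_at mu i l - zero_at mu j m|]] <= min_gap mu n.
Proof.
have [L LE] := moment_functional mu_compact.
have Lpos := moment_functional_positive mu_infinite LE.
have PO k := monic_orthopolyP k LE Lpos.
have ZE k := zero_setE k LE Lpos.
have zero_atP k y : y \in rootsR (monic_orthopoly mu k) ->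
    exists2 i, (1 <= i <= k)%N & y = zero_at mu i k.
  move=> yP; exists (index y (rootsR (monic_orthopoly mu k))).+1.
    by rewrite /= -[X in (_ <= X)%N](orthopoly_factor Lpos (PO k)).2 index_mem.
  by rewrite /zero_at nth_index.
have root_zero_at k i : (1 <= i <= k)%N ->
    root (monic_orthopoly mu k) (zero_at mu i k).
  move=> /andP[i1 ik]; have [PE sP] := orthopoly_factor Lpos (PO k).
  by rewrite PE root_prod_XsubC mem_nth// sP prednK.
split.
  rewrite /set_dist !ZE; congr inf; apply/seteqP; split.
    move=> _ [_ [i il ->] [_ [j jm ->] <-]].
    by exists i, j; split => //; rewrite normc_real_sub.
  move=> _ [i [j [il jm ->]]].
  exists (zero_at mu i l)%:C%C; first by exists i.
  by exists (zero_at mu j m)%:C%C; [exists j|rewrite normc_real_sub].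
set D := [set r | _]; apply: lb_le_inf.
  (* Since inf set0 = 0, the bound needs P_n to have two distinct zeros: this
     is where 1 < n is used. *)
  exists (ComplexField.Normc.normc ((zero_at mu 1 n)%:C - (zero_at mu 2 n)%:C)%C).
  exists (zero_at mu 1 n)%:C%C, (zero_at mu 2 n)%:C%C; split=> //.
  - by rewrite ZE; exists 1%N => //; lia.
  - by rewrite ZE; exists 2%N.
  - have uP : uniq (rootsR (monic_orthopoly mu n)).
      exact: (sorted_uniq lt_trans ltxx (sorted_roots _ _ _)).
    have sP := (orthopoly_factor Lpos (PO n)).2.
    by rewrite (inj_eq (@complexI R)) /zero_at nth_uniq// sP; lia.
move=> _ [_ [_ [/[!ZE] -[i iN ->] [j jN ->] + ->]]].
rewrite (inj_eq (@complexI R)) normc_real_sub.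
move: (root_zero_at n i iN) (root_zero_at n j jN).
move: (zero_at mu i n) (zero_at mu j n) => {i j iN jN} x x'.
wlog xx' : x x' / x < x' => [th Px Px' /[dup] xNx'|Px Px' _].
  rewrite neq_lt => /orP[|] /th; first exact.
  by rewrite distrC; apply => //; rewrite eq_sym.
have [y /zero_atP[i il ->] yb] := orthopoly_zero_between Lpos (PO n) (PO l)
  (ltn_trans hmn hlm) Px Px' xx'.
have [y' /zero_atP[j jm ->] y'b] := orthopoly_zero_between Lpos (PO n) (PO m)
  hmn Px Px' xx'.
apply: (@le_trans _ _ `|zero_at mu i l - zero_at mu j m|).
  apply: ge_inf; last by exists i, j.
  by exists 0 => _ [? [? [_ _ ->]]].
rewrite (@ler0_norm _ (x - x')); last by lra.
by rewrite ler_norml; lra.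
Qed.
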